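(* There exists $n_0$ such that for every $n \geq n_0$ the following holds. Let \[\mathcal{C} = \{\sigma \in S_n : \sigma(1) = 1,\ \sigma(i) = i \text{ for some } i > 2\} \cup \{(1\ 2)\},\] which has size $(n-1)! - d_{n-1} - d_{n-2} + 1$. If $\mathcal{A} \subset S_n$ is a non-centred intersecting family, then $|\mathcal{A}| \leq |\mathcal{C}|$. Moreover, equality holds if and only if $\mathcal{A}$ is a double translate of $\mathcal{C}$, i.e. $\mathcal{A} = \pi \mathcal{C} \tau$ for some $\pi, \tau \in S_n$.
   Context: $S_n$ is the symmetric group on $[n]=\{1,\ldots,n\}$; $(1\ 2)$ denotes the transposition swapping 1 and 2. A family $\mathcal{A} \subset S_n$ is intersecting if for any $\sigma,\pi \in \mathcal{A}$ there is some $i \in [n]$ with $\sigma(i)=\pi(i)$. An intersecting family is centred if there exist $i, j \in [n]$ such that every permutation in it maps $i$ to $j$; otherwise it is non-centred. $d_m$ denotes the number of derangements (fixed-point-free permutations) of an $m$-element set. $\pi\mathcal{C}\tau = \{\pi\sigma\tau : \sigma \in \mathcal{C}\}$. *)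

(* Defs.v *)
(* Points of [n] = {1..n} are modelled by 'I_n = {0..n-1};
   the paper's point k corresponds to the ordinal with value k-1. *)
From mathcomp Require Import all_boot all_fingroup.
Set Implicit Arguments. Unset Strict Implicit. Unset Printing Implicit Defensive.
Local Open Scope group_scope.

Definition derangements (m : nat) : nat :=
  #|[set s : {perm 'I_m} | [forall i, s i != i]]|.

Definition intersecting (n : nat) (A : {set {perm 'I_n}}) : Prop :=
  forall s t, s \in A -> t \in A -> exists i : 'I_n, s i = t i.

Definition centred (n : nat) (A : {set {perm 'I_n}}) : Prop :=
  exists i j : 'I_n, forall s, s \in A -> s i = j.

Definition pt1 (m : nat) : 'I_m.+2 := ord0.
Definition pt2 (m : nat) : 'I_m.+2 := lift ord0 ord0.

Definition familyC (m : nat) : {set {perm 'I_m.+2}} :=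
  [set s : {perm 'I_m.+2} | (s (pt1 m) == pt1 m) &&
       [exists i : 'I_m.+2, (2 <= val i) && (s i == i)]]
  :|: [set tperm (pt1 m) (pt2 m)].

(* double translate pi C tau; in MathComp (x * y) z = y (x z), so the
   paper's composite pi o s o tau is tau * s * pi. *)
Definition double_translate (n : nat) (C : {set {perm 'I_n}}) (p t : {perm 'I_n})
  : {set {perm 'I_n}} := [set t * s * p | s in C].

(* Main.v *)
(* Permutations are identified with their graphs, subsets of [n] x [n]. Call a
   partial permutation X a core of A if, for some nonempty B inside A all of
   whose members extend X, the sets (graph of s) minus X, for s in B, are
   R-spread: at most |B| / R^|U| of them contain any given U. With R about
   n^(2/3), two spread families have disjoint members: in a random colouring of
   the n^2 cells with four colours, the minimal-fragment argument of
   Alweiss-Lovasz-Wu-Zhang and Park-Pham, run for two rounds, finds with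
   probability at least 3/4 a member of the first family inside two of the
   colours, and likewise for the second family and the other two colours. Hence
   cores of an intersecting family pairwise meet. A core maximising
   R^|X| |A[X]| exists in any family that is not tiny, and it then has bounded
   size, so all but a tiny part of A extends a core of size at most 13. If no
   cell lies in all these cores, A has O((n-2)!) members and is smaller than C.
   Otherwise all members of A but a tiny set F map some i to some j. Every
   member of A outside F meets every u in F; if F = {u} this gives the bound and
   the equality case, and a second element of F would exclude at least
   (n-2)!/(2 n^2) >= |F| further permutations. *)
Require Import Defs.
From mathcomp Require Import all_boot all_fingroup.
From mathcomp Require Import zify.
Set Implicit Arguments. Unset Strict Implicit. Unset Printing Implicit Defensive.

(** * Estimates for powers, falling factorials, binomials and geometric sums *)

Lemma bin_le_exp2 n m : 'C(n, m) <= 2 ^ n.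
Proof.
case: (leqP m n) => [le_mn|lt_nm]; last by rewrite bin_small.
rewrite -[2]/(1 + 1) expnDn (bigD1 (inord m : 'I_n.+1)) //= inordK //.
by rewrite !exp1n !muln1 leq_addr.
Qed.

Lemma ffact_leq_exp n m : n ^_ m <= n ^ m.
Proof.
elim: m n => [|m IH] n //; rewrite ffactnS expnS leq_mul2l.
apply/orP; right; apply: leq_trans (IH _) _.
by case: m {IH} => // m; rewrite leq_exp2r // leq_pred.
Qed.

Lemma exp_leq_ffact n m : n ^ m <= (m + n) ^_ m.
Proof.
elim: m => [|m IH] //; rewrite ffactnS expnS leq_mul //.
by rewrite leq_addl.
Qed.

Lemma exp_self_leq_fact m : m ^ m <= 4 ^ m * m`!.
Proof.
apply: leq_trans (exp_leq_ffact m m) _.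
by rewrite -bin_ffact leq_mul // (leq_trans (bin_le_exp2 _ _)) // addnn -mul2n expnM.
Qed.

(** Stands in for C(n, m) <= (e n / m)^m, with 4 in place of e. *)
Lemma bin_mul_exp_leq n m : 'C(n, m) * m ^ m <= (4 * n) ^ m.
Proof.
apply: leq_trans (_ : 'C(n, m) * (4 ^ m * m`!) <= _).
  by rewrite leq_mul2l exp_self_leq_fact orbT.
by rewrite mulnCA bin_ffact expnMn leq_mul // ffact_leq_exp.
Qed.

(** Factor by factor: n (m - l) <= (n - l) m because m <= n. *)
Lemma exp_fact_leq_ffact n m : m <= n -> n ^ m * m`! <= n ^_ m * m ^ m.
Proof.
move=> le_mn; rewrite -ffactnn.
suff H l : l <= m -> n ^ l * m ^_ l <= n ^_ l * m ^ l by apply: H.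
elim: l => // l IH lt_lm; rewrite !expnSr !ffactnSr mulnACA [X in _ <= X]mulnACA.
apply: leq_mul; first by apply: IH; apply: ltnW.
by nia.
Qed.

Lemma exp_leq_ffact4 n m : m <= n -> n ^ m <= 4 ^ m * n ^_ m.
Proof.
move=> le_mn; rewrite -(leq_pmul2r (fact_gt0 m)).
apply: leq_trans (exp_fact_leq_ffact le_mn) _.
by rewrite -mulnA mulnCA leq_mul2l exp_self_leq_fact orbT.
Qed.

Lemma sum_geometric_leq (B : nat -> nat) (Q l : nat) :
    (forall t, 0 < t -> B t * 32 ^ t <= Q) ->
  (\sum_(1 <= t < l.+1) B t) * 16 <= Q.
Proof.
move=> HB.
(* The reserve [Q %/ 2 ^ l] drives the induction: the next term takes at most [Q %/ 2 ^ l.+1], and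
   as much stays in reserve. *)
suff: (\sum_(1 <= t < l.+1) B t) * 16 + Q %/ 2 ^ l <= Q by apply: leq_trans (leq_addr _ _).
elim: l => [|l IH]; first by rewrite big_geq // expn0 divn1.
rewrite big_nat_recr //= mulnDl.
apply: leq_trans IH; rewrite -addnA leq_add2l.
have h1 : B l.+1 * 16 <= Q %/ 2 ^ l.+1.
  rewrite leq_divRL ?expn_gt0 // (leq_trans _ (HB l.+1 _)) // -mulnA leq_mul2l.
  by rewrite -[32]/(16 * 2) expnMn leq_mul2r [16 ^ _]expnS leq_pmulr ?orbT ?expn_gt0.
apply: leq_trans (leq_add h1 (leqnn _)) _.
rewrite addnn -muln2 expnSr divnMA.
by rewrite leq_divM.
Qed.

(** * Minimum fragments *)

Section Fragment.
Variables (E I : finType) (D : {set I}) (S : I -> {set E}) (W : {set E}).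

(** The minimum fragment of Park and Pham. The default [i] of the arg min is itself a competitor as
    soon as [i \in D]. *)
Definition fragment (i : I) : {set E} :=
  S [arg min_(j < i | (j \in D) && (S j \subset W :|: S i)) #|S j :\: W|] :\: W.

Lemma fragmentP i : i \in D ->
  exists j, [/\ j \in D, S j \subset W :|: S i, fragment i = S j :\: W &
    forall l, l \in D -> S l \subset W :|: S i -> #|fragment i| <= #|S l :\: W| ].
Proof.
move=> Di; rewrite /fragment; case: arg_minnP => [|j /andP[Dj sj] jmin].
  by rewrite Di subsetUr.
by exists j; split=> // l Dl sl; apply: jmin; rewrite Dl.
Qed.

Lemma fragment_disjoint i : [disjoint fragment i & W].
Proof.
rewrite /fragment -setI_eq0; apply/eqP/setP=> e; rewrite !inE.
by case: (e \in W); rewrite ?andbF.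
Qed.

Lemma fragment_sub i : i \in D -> fragment i \subset S i :\: W.
Proof.
case/fragmentP=> j [_ /subsetP sj -> _]; apply/subsetP=> e; rewrite !inE.
by case/andP=> eW /sj; rewrite inE (negPf eW).
Qed.

(* Whatever member lies inside [W :|: fragment i] competes in the minimum defining the fragment. *)
Lemma fragment_sub_witness i l : i \in D -> l \in D ->
  S l \subset W :|: fragment i -> fragment i \subset S l.
Proof.
move=> Di Dl sl; have fi := fragment_sub Di.
have [j [_ _ _ jmin]] := fragmentP Di.
have sl1 : S l :\: W \subset fragment i.
  by rewrite subDset.
have sl2 : S l \subset W :|: S i.
  apply: subset_trans sl _; apply: setUS; apply: subset_trans fi _; exact: subsetDl.
have /eqP <- : S l :\: W == fragment i by rewrite eqEcard sl1 jmin.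
exact: subsetDl.
Qed.

End Fragment.

(** * Colourings and recolourings of the ground set *)

Section Recolouring.
Variables (E K : finType).
Implicit Type c : {ffun E -> K}.

Definition colour_class c (b : K) : {set E} := [set e | c e == b].
Definition recolour c (U : {set E}) (b : K) : {ffun E -> K} :=
  [ffun e => if e \in U then b else c e].

Lemma colour_class_recolour c U b :
  colour_class (recolour c U b) b = colour_class c b :|: U.
Proof. by apply/setP=> e; rewrite !inE ffunE; case: (e \in U); rewrite ?eqxx ?orbT ?orbF. Qed.

Lemma colour_class_recolour_neq c (U : {set E}) a b : a != b ->
  [disjoint U & colour_class c a] ->
  colour_class (recolour c U b) a = colour_class c a.
Proof.
move=> ab /pred0P dU; apply/setP=> e; rewrite !inE ffunE; case: ifP => // eU.
by have /= := dU e; rewrite !inE eU [b == a]eq_sym (negPf ab) /= => ->.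
Qed.

Lemma card_agree_off c (U : {set E}) :
  #|[set c' : {ffun E -> K} | [forall (e | e \notin U), c' e == c e]]| = #|K| ^ #|U|.
Proof.
pose F e : pred K := if e \in U then predT else pred1 (c e).
rewrite (_ : #|_| = #|family F|).
  rewrite card_family foldrE big_map big_enum /= (bigID (mem U)) /=.
  rewrite (eq_bigr (fun=> #|K|)) => [|e eU]; last by rewrite /F eU.
  rewrite prod_nat_const [X in _ * X]big1 ?muln1 // => e /negPf eU.
  by rewrite /F eU card1.
apply: eq_card => c'; rewrite !inE; apply: eq_forallb => e.
by rewrite -[RHS]/(F e (c' e)) /F; case: (e \in U).
Qed.
End Recolouring.

(** * Counting pairs with a large fragment in one round *)

Section Round.
Variables (E I K : finType) (b : K) (L : Type).
(** [key c] is the part of the colouring that determines the family: nothing in the first round, the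
    first colour class in the second. By [key_recolour] the family survives the recolouring of a
    fragment. *)
Variables (key : {ffun E -> K} -> L) (D : L -> {set I}) (S : L -> I -> {set E}).
Variables (k R M : nat).
Hypothesis key_recolour : forall c i (U : {set E}), i \in D (key c) -> U \subset S (key c) i ->
  [disjoint U & colour_class c b] -> key (recolour c U b) = key c.
Hypothesis card_S : forall l i, i \in D l -> #|S l i| <= k.
Hypothesis spread : forall l (U : {set E}), #|[set i in D l | U \subset S l i]| * R ^ #|U| <= M.

Let frag c i := fragment (D (key c)) (S (key c)) (colour_class c b) i.

(** The [pick] consults the colouring alone, so the candidates can be listed from the recoloured
    colouring without knowing the encoded pair. *)
Let witness c (t : nat) : {set {set E}} :=
  if [pick j | (j \in D (key c)) && (S (key c) j \subset colour_class c b)] is Some j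
  then [set U : {set E} | U \subset S (key c) j & #|U| == t] else set0.

Let card_witness c (t : nat) : #|witness c t| <= 'C(k, t).
Proof.
rewrite /witness; case: pickP => [j /andP[Dj _]|_]; last by rewrite cards0.
by rewrite cards_draws leq_bin2l // card_S.
Qed.

(* An exceptional pair is encoded by the recolouring that gives the fragment
   the colour [b]: the fragment is recovered as a [t]-subset of a member lying in
   the enlarged colour class, at the cost of only ['C(k, t)] choices. *)
Lemma round_bound (t : nat) :
  #|[set x : I * {ffun E -> K} | (x.1 \in D (key x.2)) && (#|frag x.2 x.1| == t)]| * R ^ t
   <= #|K| ^ #|E| * (#|K| ^ t * 'C(k, t) * M).
Proof.
pose agree (c c' : {ffun E -> K}) (U : {set E}) := [forall (e | e \notin U), c' e == c e].
pose meet (c : {ffun E -> K}) (U : {set E}) i := (i \in D (key c)) && (U \subset S (key c) i).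
have step : #|[set x : I * {ffun E -> K} | (x.1 \in D (key x.2)) && (#|frag x.2 x.1| == t)]|
   <= \sum_(c' : {ffun E -> K}) \sum_(U in witness c' t)
      \sum_(x : I * {ffun E -> K} | agree c' x.2 U && meet c' U x.1) 1.
  rewrite -sum1_card.
  have -> : \sum_(c' : {ffun E -> K}) \sum_(U in witness c' t)
      \sum_(x : I * {ffun E -> K} | agree c' x.2 U && meet c' U x.1) 1 =
     \sum_(x : I * {ffun E -> K}) \sum_(c' : {ffun E -> K})
      \sum_(U in witness c' t | agree c' x.2 U && meet c' U x.1) 1.
    rewrite [RHS]exchange_big; apply: eq_bigr => c' _ /=.
    by rewrite (exchange_big_dep predT).
  rewrite big_mkcond leq_sum //= => -[i c] _; rewrite inE /=.
  case: ifP => // /andP[Di /eqP ft].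
  pose U := frag c i; pose c' := recolour c U b.
  have US := fragment_sub (S (key c)) (colour_class c b) Di.
  have dU : [disjoint U & colour_class c b] by apply: fragment_disjoint.
  have kc : key c' = key c.
    apply: key_recolour Di _ dU; apply: subset_trans US _; exact: subsetDl.
  have Uw : U \in witness c' t.
    (* The minimiser defining the fragment lies in the enlarged class, so the [pick] succeeds;
       whichever member it returns contains the fragment. *)
    rewrite /witness kc; case: pickP => [j /andP[Dj]|none].
      rewrite colour_class_recolour inE ft eqxx andbT => sj.
      exact: fragment_sub_witness Di Dj sj.
    have [j [Dj sj fj _]] := fragmentP (S (key c)) (colour_class c b) Di.
    have := none j; rewrite Dj colour_class_recolour /U /frag fj.
    by rewrite -subDset subxx.
  rewrite (bigD1 c') //= (bigD1 U) //=; last first.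
    rewrite Uw /meet kc Di (subset_trans US (subsetDl _ _)) !andbT.
    by apply/forall_inP=> e eU; rewrite ffunE (negPf eU).
apply: leq_trans (leq_mul step (leqnn _)) _.
rewrite big_distrl /=.
rewrite -card_ffun -sum_nat_const leq_sum // => c' _.
rewrite big_distrl /=.
apply: (@leq_trans (\sum_(U in witness c' t) #|K| ^ t * M)); last first.
  by rewrite sum_nat_const mulnC -!mulnA leq_mul2l [M * _]mulnC leq_mul2r card_witness !orbT.
apply: leq_sum => U Uw.
have cU : #|U| = t.
  move: Uw; rewrite /witness; case: pickP => [j _|_]; last by rewrite inE.
  by rewrite inE => /andP[_ /eqP].
(* The pair now splits: the original colouring is free only on [U], and the index ranges over
   members containing [U]. *)
rewrite (_ : \sum_(x | _) 1 = #|K| ^ t * #|[set i in D (key c') | U \subset S (key c') i]|).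
  by rewrite -mulnA leq_mul2l -cU spread orbT.
rewrite -cU -(card_agree_off c') -sum1_card.
rewrite sum1_card mulnC -cardsX -sum1_card; apply: eq_bigl => -[i c] /=.
by rewrite !inE andbC.
Qed.
End Round.

Lemma card_positive_values (X : finType) (P : pred X) (f : X -> nat) n :
  #|[set x | P x && (0 < f x <= n)]| <= \sum_(1 <= t < n.+1) #|[set x | P x && (f x == t)]|.
Proof.
elim: n => [|n IH].
  rewrite big_geq // leqn0 cards_eq0; apply/eqP/setP=> x; rewrite !inE; lia.
rewrite big_nat_recr //=; apply: leq_trans (leq_add IH (leqnn _)).
apply: leq_trans (leq_card_setU _ _); apply/subset_leq_card/subsetP=> x.
by rewrite !inE; lia.
Qed.

(** * Two rounds, and disjoint members of two spread families *)

Section TwoRounds.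
Variables (E I K : finType) (a b : K) (D : {set I}) (S : I -> {set E}).
Variables (n R M t0 : nat).
Hypothesis neq_ab : a != b.
Hypothesis card_K : #|K| = 4.
Hypothesis card_S : forall i, i \in D -> #|S i| <= n.
Hypothesis spread : forall U : {set E}, #|[set i in D | U \subset S i]| * R ^ #|U| <= M.
Hypothesis (n_gt0 : 0 < n) (t0_gt0 : 0 < t0) (D_gt0 : 0 < #|D|) (leMD : M <= 2 * #|D|).
Hypothesis (le_nR : 512 * n <= t0 * R) (le_t0R : 128 * t0 <= R).

(** The fragments of these indices, all smaller than [t0], are the members of the second-round
    family. *)
Let D1 (W : {set E}) := [set i in D | #|fragment D S W i| < t0].
Let frag1 (c : {ffun E -> K}) i := fragment D S (colour_class c a) i.
Let frag2 (c : {ffun E -> K}) i :=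
  fragment (D1 (colour_class c a)) (fragment D S (colour_class c a)) (colour_class c b) i.
Let Q := 4 ^ #|E| * M.

(** The count is at most Q (16 n / (t R))^t, and t >= t0 with 512 n <= t0 R makes the base at most
    1/32. *)
Let round1 t : t0 <= t ->
  #|[set x : I * {ffun E -> K} | (x.1 \in D) && (#|frag1 x.2 x.1| == t)]| * 32 ^ t <= Q.
Proof.
move=> le_t0t.
have H := @round_bound E I K a unit (fun=> tt) (fun=> D) (fun=> S) n R M
  (fun _ _ _ _ _ _ => erefl) (fun=> card_S) (fun=> spread) t.
rewrite -/(frag1 _ _) card_K in H.
have t_gt0 : 0 < t by apply: leq_trans le_t0t.
rewrite -(@leq_pmul2r ((16 * n) ^ t)) ?expn_gt0 ?muln_gt0 ?n_gt0 //.
rewrite -mulnA -expnMn mulnA -[32 * 16]/512.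
apply: (@leq_trans (#|[set x : I * {ffun E -> K} | (x.1 \in D) && (#|frag1 x.2 x.1| == t)]| * (t * R) ^ t)).
  rewrite leq_mul2l leq_exp2r // (leq_trans le_nR) ?orbT //.
  by rewrite leq_mul2r le_t0t orbT.
rewrite [t * R]mulnC expnMn mulnA.
apply: leq_trans (leq_mul H (leqnn _)) _.
have -> : 4 ^ #|E| * (4 ^ t * 'C(n, t) * M) * t ^ t = Q * (4 ^ t * ('C(n, t) * t ^ t)).
  by rewrite /Q; lia.
rewrite -[16]/(4 * 4) -(mulnA 4) (expnMn 4) !leq_mul2l.
apply/orP; right; apply/orP; right.
exact: bin_mul_exp_leq.
Qed.

(** Members now have size at most [t0], so C(t0, t) <= t0^t gives Q (4 t0 / R)^t, with base at most
    1/32. *)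
Let round2 t : 0 < t ->
  #|[set x : I * {ffun E -> K} | (x.1 \in D1 (colour_class x.2 a)) && (#|frag2 x.2 x.1| == t)]|
     * 32 ^ t <= Q.
Proof.
move=> t_gt0.
have H := @round_bound E I K b _ (fun c => colour_class c a) D1 (fragment D S) t0 R M.
rewrite -(@leq_pmul2r ((4 * t0) ^ t)) ?expn_gt0 ?muln_gt0 ?t0_gt0 //.
rewrite -mulnA -expnMn mulnA -[32 * 4]/128.
apply: (@leq_trans (#|[set x : I * {ffun E -> K} | (x.1 \in D1 (colour_class x.2 a)) && (#|frag2 x.2 x.1| == t)]| * R ^ t)).
  by rewrite leq_mul2l leq_exp2r // le_t0R orbT.
apply: leq_trans (H _ _ _ t) _.
(* First-round fragments avoid colour [a], so recolouring part of one with [b] leaves the first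
   class alone. *)
- move=> c i U Di sU dU; apply: colour_class_recolour_neq => //.
  exact: disjointWl sU (fragment_disjoint _ _ _ _).
- by move=> W i; rewrite inE => /andP[_ /ltnW].
(* Fragments are subsets of the original members and inherit their spreadness. *)
- move=> W U; apply: leq_trans (spread U); rewrite leq_mul2r subset_leq_card ?orbT //.
  apply/subsetP=> i; rewrite !inE => /andP[/andP[Di _] sU]; rewrite Di.
  by rewrite (subset_trans sU) // (subset_trans (fragment_sub S W Di)) ?subsetDl.
rewrite card_K.
have -> : 4 ^ #|E| * (4 ^ t * 'C(t0, t) * M) = Q * (4 ^ t * 'C(t0, t)).
  by rewrite /Q; lia.
rewrite (expnMn 4) !leq_mul2l.
apply/orP; right; apply/orP; right.
apply: leq_trans (ffact_leq_exp t0 t); rewrite -bin_ffact.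
by rewrite leq_pmulr ?fact_gt0.
Qed.

(** In a bad colouring every index of [D] has a first fragment of size at least [t0] or a nonempty
    second fragment. Each kind accounts for at most Q/16 pairs, so |D| times the number of bad
    colourings is at most Q/8, and M <= 2 |D| concludes. *)
Lemma few_uncovered_colourings :
  4 * #|[set c : {ffun E -> K} |
         [forall i in D, ~~ (S i \subset colour_class c a :|: colour_class c b)]]| <= 4 ^ #|E|.
Proof.
set bad := [set c | _].
pose P1 (x : I * {ffun E -> K}) := (x.1 \in D) && (t0 <= #|frag1 x.2 x.1|).
pose P2 (x : I * {ffun E -> K}) := x.1 \in D1 (colour_class x.2 a).
pose X1 := [set x | P1 x && (0 < #|frag1 x.2 x.1| <= n)].
pose X2 := [set x | P2 x && (0 < #|frag2 x.2 x.1| <= t0)].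
have c1 : #|X1| * 16 <= Q.
  apply: leq_trans (leq_mul (card_positive_values _ _ _) (leqnn _)) _.
  apply: sum_geometric_leq => t t_gt0.
  case: (leqP t0 t) => [le_t|lt_t].
    apply: leq_trans (round1 le_t); rewrite leq_mul2r subset_leq_card ?orbT //.
    by apply/subsetP=> x; rewrite !inE => /andP[/andP[-> _] ->].
  rewrite (_ : [set x | _] = set0) ?cards0 //.
  apply/setP=> x; rewrite [RHS]inE inE /P1; apply/negP=> /andP[/andP[_ h] /eqP ft].
  by rewrite ft leqNgt lt_t in h.
have c2 : #|X2| * 16 <= Q.
  apply: leq_trans (leq_mul (card_positive_values _ _ _) (leqnn _)) _.
  by apply: sum_geometric_leq => t t_gt0; apply: round2.
have sub : setX D bad \subset X1 :|: X2.
  apply/subsetP=> -[i c] /setXP[/= Di]; rewrite inE => /forall_inP nc.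
  rewrite in_setU; case: (leqP t0 #|frag1 c i|) => [le_t|lt_t].
    apply/orP; left; rewrite inE /P1 /= Di le_t (leq_trans t0_gt0 le_t) /=.
    apply: leq_trans (card_S Di); apply: subset_leq_card.
    by apply: subset_trans (fragment_sub _ _ Di) (subsetDl _ _).
  have D1i : i \in D1 (colour_class c a) by rewrite inE Di.
  apply/orP; right; rewrite inE /P2 /= D1i /=.
  have le2 : #|frag2 c i| <= t0.
    apply: leq_trans (ltnW lt_t); apply: subset_leq_card.
    by apply: subset_trans (fragment_sub _ _ D1i) (subsetDl _ _).
  rewrite le2 andbT lt0n cards_eq0; apply/negP=> /eqP f0.
  (* An empty second fragment puts some first fragment inside class [b]; the member [S l] behind it
     then lies in the two classes. *)
  have [j [D1j _ fj _]] := fragmentP (fragment D S (colour_class c a)) (colour_class c b) D1i.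
  have Dj : j \in D by move: D1j; rewrite inE => /andP[].
  have [l [Dl _ fl _]] := fragmentP S (colour_class c a) Dj.
  have := nc l Dl; apply/negP; rewrite negbK -subDset -fl.
  by rewrite -setD_eq0 -fj -/(frag2 c i) f0.
have := subset_leq_card sub; rewrite cardsX => H.
have H2 := leq_trans H (leq_card_setU _ _).
rewrite -(leq_pmul2r D_gt0).
have : 4 ^ #|E| * M <= 4 ^ #|E| * (2 * #|D|) by rewrite leq_mul2l leMD orbT.
rewrite -/Q; move: c1 c2 H2; nia.
Qed.
End TwoRounds.

(** Each family fails for at most a quarter of the colourings, so one colouring serves both, with
    disjoint pairs of colours. *)
Lemma spread_disjoint (E I I' : finType) (D : {set I}) (D' : {set I'})
    (S : I -> {set E}) (S' : I' -> {set E}) (n R M M' t0 : nat) :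
    (forall i, i \in D -> #|S i| <= n) -> (forall i, i \in D' -> #|S' i| <= n) ->
    (forall U : {set E}, #|[set i in D | U \subset S i]| * R ^ #|U| <= M) ->
    (forall U : {set E}, #|[set i in D' | U \subset S' i]| * R ^ #|U| <= M') ->
    0 < n -> 0 < t0 -> 0 < #|D| -> 0 < #|D'| -> M <= 2 * #|D| -> M' <= 2 * #|D'| ->
    512 * n <= t0 * R -> 128 * t0 <= R ->
  exists i j, [/\ i \in D, j \in D' & [disjoint S i & S' j]].
Proof.
move=> cS cS' sp sp' n0 t0_gt0 D0 D0' leM leM' le1 le2.
pose K := 'I_4; pose col (i : nat) : K := inord i.
have colE i j : i < 4 -> j < 4 -> (col i == col j) = (i == j).
  by move=> hi hj; rewrite -val_eqE /= !inordK.
have cK : #|K| = 4 by rewrite card_ord.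
have ab : col 0 != col 1 by rewrite colE.
have ab' : col 2 != col 3 by rewrite colE.
have := few_uncovered_colourings ab cK cS sp n0 t0_gt0 D0 leM le1 le2.
have := few_uncovered_colourings ab' cK cS' sp' n0 t0_gt0 D0' leM' le1 le2.
set bad' := [set c | _]; set bad := [set c | _] => H' H.
have [c] : exists c, c \notin bad :|: bad'.
  apply/existsP; rewrite -negb_forall; apply/negP=> /forallP all_bad.
  have cT : #|bad :|: bad'| = 4 ^ #|E|.
    rewrite (eq_card (_ : _ =i [set: {ffun E -> K}])) ?cardsT ?card_ffun ?cK //.
    by move=> c; rewrite all_bad inE.
  have [+ _] := leq_card_setU bad bad'; rewrite cT.
  have : 0 < 4 ^ #|E| by rewrite expn_gt0.
  lia.
rewrite inE negb_or !inE.
move=> /andP[/forall_inPn[i Di /negPn si] /forall_inPn[j Dj /negPn sj]].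
exists i, j; split=> //; rewrite -setI_eq0; apply/eqP/setP=> e; rewrite !inE.
apply/negP=> /andP[/(subsetP si)]; rewrite !inE => ci /(subsetP sj); rewrite !inE.
by move: ci => /orP[] /eqP ->; rewrite !colE.
Qed.

(** * Graphs of permutations and spread cores *)

Section Graphs.
Variable T : finType.
Implicit Types (s t : {perm T}) (A B : {set {perm T}}) (X Y U : {set T * T}).

Definition graph s : {set T * T} := [set x | s x.1 == x.2].
Definition extending A X : {set {perm T}} := [set s in A | X \subset graph s].

Lemma in_graph s x y : ((x, y) \in graph s) = (s x == y).
Proof. by rewrite inE. Qed.

Lemma card_graph s : #|graph s| = #|T|.
Proof.
rewrite (_ : graph s = [set (x, s x) | x in T]).
  by rewrite card_imset // => x y [].
apply/setP=> -[x y]; rewrite in_graph; apply/eqP/imsetP=> [<-|[z _ [-> ->]]] //.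
by exists x.
Qed.

(** Multiplying by the inverse of [s] turns extensions of [X] into permutations supported off the
    first coordinates of [X]. *)
Lemma card_extending_eq s X : X \subset graph s ->
  #|extending setT X| = (#|T| - #|X|)`!.
Proof.
move=> sX; pose dom := [set x.1 | x in X].
have cdom : #|dom| = #|X|.
  apply: card_in_imset => -[x y] [x' y'] /(subsetP sX) + /(subsetP sX).
  by rewrite !in_graph /= => /eqP <- /eqP <- ->.
have -> : extending setT X = [set (p * s)%g | p in [pred p | perm_on (~: dom) p]].
  apply/setP=> t; rewrite !inE /=; apply/subsetP/imsetP=> [tX|[p pX ->] [x y] xyX].
    exists (t * s^-1)%g; last by rewrite mulgKV.
    rewrite inE; apply/subsetP=> x; rewrite !inE; apply: contra => /imsetP[[x1 y1] xyX ->] /=.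
    rewrite permM; move: (tX _ xyX) (subsetP sX _ xyX); rewrite !in_graph => /eqP -> /eqP <-.
    by rewrite permK.
  rewrite in_graph permM (out_perm pX); first by have := subsetP sX _ xyX; rewrite in_graph.
  by rewrite !inE negbK; apply/imsetP; exists (x, y).
rewrite card_imset; last exact: mulIg.
by rewrite card_perm cardsCs setCK cdom.
Qed.

Lemma card_extending A X : #|extending A X| <= (#|T| - #|X|)`!.
Proof.
case: (set_0Vmem (extending A X)) => [->|[s]]; first by rewrite cards0.
rewrite inE => /andP[_ sX]; rewrite -(card_extending_eq sX).
by apply/subset_leq_card/subsetP=> t; rewrite !inE => /andP[_ ->].
Qed.

(** Asking for some [B] instead of all of [extending A X] makes the notion monotone in [A]. *)
Definition spread_core A (R : nat) X :=
  [exists B : {set {perm T}}, [&& B \subset extending A X, B != set0 &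
    [forall U : {set T * T}, [disjoint U & X] ==> (#|extending B U| * R ^ #|U| <= #|B|)]]].

Lemma spread_core_sub A B R X : A \subset B -> spread_core A R X -> spread_core B R X.
Proof.
move=> sAB /existsP[C /and3P[sC nC spC]]; apply/existsP; exists C; rewrite nC spC !andbT.
apply: subset_trans sC _; apply/subsetP=> s; rewrite !inE => /andP[/(subsetP sAB) ->].
by [].
Qed.

(** Take [X] maximising R^|X| |A[X]|: comparison with [X :|: U] gives spreadness, comparison with
    [set0] the size bound. *)
Lemma spread_core_exists A R : A != set0 -> 0 < R ->
  exists X, [/\ spread_core A R X, extending A X != set0 & #|A| <= R ^ #|X| * (#|T| - #|X|)`!].
Proof.
move=> nA R0; have A0 : 0 < #|A| by rewrite card_gt0.
have e0 : extending A set0 = A.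
  by apply/setP=> s; rewrite inE sub0set andbT.
case: (@arg_maxnP _ (set0 : {set T * T}) predT (fun X => R ^ #|X| * #|extending A X|) isT) => X _ Xmax.
have := Xmax set0 isT; rewrite cards0 expn0 mul1n e0 => HA.
have nX : extending A X != set0.
  by apply/negP=> /eqP h; move: HA; rewrite h cards0 muln0; lia.
exists X; split=> //; last first.
  by apply: leq_trans HA _; rewrite leq_mul2l card_extending orbT.
apply/existsP; exists (extending A X); rewrite subxx nX /=.
apply/forall_inP=> U dU; have := Xmax (X :|: U) isT => /=.
have -> : extending A (X :|: U) = extending (extending A X) U.
  by apply/setP=> s; rewrite !inE subUset andbA.
rewrite cardsU disjoint_setI0 1?disjoint_sym // cards0 subn0 expnD -mulnA leq_pmul2l ?expn_gt0 ?R0 //.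
by rewrite mulnC.
Qed.

Lemma card_extending_hit A X (m R : nat) :
    (forall x, x \in X -> #|extending A [set x]| * R <= m) ->
  #|[set s in A | ~~ [disjoint graph s & X]]| * R <= #|X| * m.
Proof.
move=> H.
apply: (@leq_trans ((\sum_(x in X) #|extending A [set x]|) * R)).
  rewrite leq_mul2r; apply/orP; right.
  apply: leq_trans (_ : #|\bigcup_(x in X) extending A [set x]| <= _).
    apply/subset_leq_card/subsetP=> s; rewrite inE => /andP[As].
    rewrite -setI_eq0 => /set0Pn[x]; rewrite inE => /andP[sx xX].
    by apply/bigcupP; exists x => //; rewrite inE As sub1set.
  apply: (big_ind2 (fun (Z : {set {perm T}}) k => #|Z| <= k)) => //; first by rewrite cards0.
  by move=> Z1 k1 Z2 k2 h1 h2; apply: leq_trans (leq_card_setU _ _) (leq_add h1 h2).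
by rewrite big_distrl /= -sum_nat_const leq_sum.
Qed.

Section Cores.
Variables (A : {set {perm T}}) (R t0 q : nat).
Hypothesis Aint : forall s t, s \in A -> t \in A -> exists x, s x = t x.
Hypothesis (T_gt0 : 0 < #|T|) (t0_gt0 : 0 < t0).
Hypothesis (le_nR : 512 * #|T| <= t0 * R) (le_t0R : 128 * t0 <= R) (le_qR : 2 * q <= R).

(** Each cell of [Y] lies in at most |B|/R members of the spread family [B], so discarding those
    that meet [Y] loses at most half. This is where the slack M <= 2 |D| comes from. *)
Lemma core_avoiding X Y : spread_core A R X -> [disjoint Y & X] -> #|Y| <= q ->
  exists (D : {set {perm T}}) (M : nat),
    [/\ D \subset extending A X, (forall s, s \in D -> [disjoint graph s & Y]),
        0 < #|D|, M <= 2 * #|D| &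
        forall U, #|[set s in D | U \subset graph s :\: X]| * R ^ #|U| <= M].
Proof.
case/existsP=> B /and3P[sB nB /forall_inP spB] dYX cY.
have R_gt0 : 0 < R by lia.
have B_gt0 : 0 < #|B| by rewrite card_gt0.
pose H := [set s in B | ~~ [disjoint graph s & Y]].
pose D := [set s in B | [disjoint graph s & Y]].
have cH : #|H| * R <= #|Y| * #|B|.
  apply: card_extending_hit => x xY; rewrite -[R]expn1 -(cards1 x); apply: spB.
  by rewrite disjoints1; have := disjointFr dYX xY => ->.
have cBD : #|B| = #|D| + #|H|.
  rewrite -(cardsID [set s | [disjoint graph s & Y]] B); congr (_ + _); apply: eq_card => s.
    by rewrite !inE.
  by rewrite !inE andbC.
have H2 : 2 * #|H| <= #|B|.
  rewrite -(leq_pmul2r R_gt0) -mulnA (leq_trans (leq_mul (leqnn 2) cH)) // mulnA mulnC.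
  by rewrite leq_mul2l (leq_trans _ le_qR) ?orbT // leq_mul2l cY orbT.
exists D, #|B|; split; [| | lia | lia |].
- by apply: subset_trans sB; apply/subsetP=> s; rewrite inE => /andP[].
- by move=> s; rewrite inE => /andP[].
move=> U; case: (boolP [disjoint U & X]) => [dU|ndU].
  apply: leq_trans (spB U dU); rewrite leq_mul2r subset_leq_card ?orbT //.
  apply/subsetP=> s; rewrite !inE => /andP[/andP[-> _] sU] /=.
  exact: subset_trans sU (subsetDl _ _).
rewrite (_ : [set s in D | _] = set0) ?cards0 //; apply/setP=> s; rewrite !inE.
apply/negP=> /andP[_ sU]; case/negP: ndU; apply: disjointWl sU _.
by rewrite -setI_eq0; apply/eqP/setP=> e; rewrite !inE; case: (e \in X); rewrite ?andbF.
Qed.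

(** For disjoint cores, take members [s] avoiding [Y] and [t] avoiding [X] that are disjoint outside
    the cores. A common cell of their graphs would lie in neither core, hence in both remainders. *)
Lemma core_meet X Y : spread_core A R X -> spread_core A R Y ->
  #|X| <= q -> #|Y| <= q -> ~~ [disjoint X & Y].
Proof.
move=> cX cY hX hY; apply/negP=> dXY.
have dYX : [disjoint Y & X] by rewrite disjoint_sym.
have [D [M [sD aD D0 leM spD]]] := core_avoiding cX dYX hY.
have [D' [M' [sD' aD' D0' leM' spD']]] := core_avoiding cY dXY hX.
have cg Z s : #|graph s :\: Z| <= #|T|.
  by rewrite -(card_graph s) subset_leq_card // subsetDl.
have [s [t [Ds Dt dst]]] := spread_disjoint (fun s _ => cg X s) (fun s _ => cg Y s) spD spD'
   T_gt0 t0_gt0 D0 D0' leM leM' le_nR le_t0R.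
have [As sX] : s \in A /\ X \subset graph s.
  by have := subsetP sD _ Ds; rewrite inE => /andP[].
have [At tY] : t \in A /\ Y \subset graph t.
  by have := subsetP sD' _ Dt; rewrite inE => /andP[].
have [x sxtx] := Aint As At.
have es : (x, s x) \in graph s by rewrite in_graph.
have et : (x, s x) \in graph t by rewrite in_graph sxtx.
have nY := disjointFr (aD _ Ds) es; have nX := disjointFr (aD' _ Dt) et.
have := disjointFr dst (_ : (x, s x) \in graph s :\: X).
by rewrite !in_setD nX es nY et /= => /(_ isT).
Qed.

End Cores.
End Graphs.

(** * Stability: one dominant cell, or a small family *)

Lemma leq_card_bigcup (I T : finType) (P : pred I) (F : I -> {set T}) (m : nat) :
  (forall i, P i -> #|F i| <= m) -> #|\bigcup_(i | P i) F i| <= #|P| * m.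
Proof.
move=> H; rewrite -sum_nat_const.
apply: leq_trans (leq_sum _ H).
apply: (big_ind2 (fun (Z : {set T}) k => #|Z| <= k)) => //; first by rewrite cards0.
move=> Z1 k1 Z2 k2 h1 h2; apply: leq_trans (leq_add h1 h2).
by have [] := leq_card_setU Z1 Z2.
Qed.

Section Stability.
Variables (T : finType) (A : {set {perm T}}) (R t0 q : nat).
Let n := #|T|.
Hypothesis Aint : forall s t, s \in A -> t \in A -> exists x, s x = t x.
Hypothesis (n_gt1 : 1 < n) (t0_gt0 : 0 < t0).
Hypothesis (le_nR : 512 * n <= t0 * R) (le_t0R : 128 * t0 <= R) (le_qR : 2 * q <= R).
Hypothesis large_core : forall x, q < x -> 2 * n ^ 4 * (4 * R) ^ x <= n ^ x.

Let core X := spread_core A R X && (#|X| <= q).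
Let rest := [set s in A | [forall X, core X ==> ~~ (X \subset graph s)]].

(** A larger [rest] would have a core with |rest| <= R^x (n - x)!. Being also a core of [A], it has
    size x > q by the choice of [rest], and [large_core] then makes this bound too small. *)
Let card_rest : #|rest| * (2 * n ^ 2) <= (n - 2)`!.
Proof.
have R_gt0 : 0 < R by lia.
rewrite leqNgt; apply/negP=> big.
have rest_n0 : rest != set0.
  by apply/negP=> /eqP r0; move: big; rewrite r0 cards0 mul0n ltn0.
have [X [cX /set0Pn[s] ]] := spread_core_exists rest_n0 R_gt0.
rewrite inE => /andP[+ sX] le_rest.
rewrite inE => /andP[_ /forall_inP nocore].
have cAX : spread_core A R X.
  by apply: spread_core_sub cX; apply/subsetP=> t; rewrite inE => /andP[].
have lt_qX : q < #|X|.
  by rewrite ltnNge; apply/negP=> le_q; have := nocore X; rewrite /core cAX le_q sX => /(_ isT).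
have le_Xn : #|X| <= n by rewrite /n -(card_graph s) subset_leq_card.
set x := #|X| in lt_qX le_Xn le_rest.
have nfact : n`! <= n ^ 2 * (n - 2)`!.
  by rewrite -(ffact_fact (n_gt1 : 2 <= n)) leq_mul2r ffact_leq_exp orbT.
(* The 2 n^4 is n^2 from n! <= n^2 (n - 2)! times the 2 n^2 from the assumed size of [rest]. *)
have fx : n ^_ x < 2 * n ^ 4 * R ^ x.
  rewrite -(ltn_pmul2r (fact_gt0 n)).
  apply: (@leq_ltn_trans (n ^_ x * (n ^ 2 * (n - 2)`!))).
    by rewrite leq_mul2l nfact orbT.
  apply: (@leq_trans (n ^_ x * (n ^ 2 * (R ^ x * (n - x)`! * (2 * n ^ 2))))).
    rewrite ltn_pmul2l ?ffact_gt0 // ltn_pmul2l ?expn_gt0 ?(ltnW n_gt1) //.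
    by apply: leq_trans big _; rewrite leq_mul2r le_rest orbT.
  rewrite -(ffact_fact le_Xn); lia.
have := large_core lt_qX; rewrite leqNgt => /negP; apply.
apply: leq_ltn_trans (exp_leq_ffact4 le_Xn) _.
by rewrite expnMn mulnCA ltn_pmul2l ?expn_gt0.
Qed.

(** Without a common cell, each cell p of a fixed core is missed by some core [X p]. A core inside
    the graph of [s] meets both, so [s] contains one of at most q^2 pairs of distinct cells. *)
Lemma stability :
  (exists x y, #|[set s in A | s x != y]| * (2 * n ^ 2) <= (n - 2)`!) \/
  #|A| <= (q ^ 2).+1 * (n - 2)`!.
Proof.
have /card_gt0P[x0 _] : 0 < #|T| by apply: ltnW.
case: (boolP [exists p, [forall X, core X ==> (p \in X)]]).
  case/existsP=> -[x y] /forall_inP Hp; left; exists x, y.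
  apply: leq_trans card_rest; rewrite leq_mul2r subset_leq_card ?orbT //.
  apply/subsetP=> s; rewrite !inE => /andP[-> sxy] /=.
  apply/forall_inP=> X /Hp xyX; apply: contra sxy => /subsetP/(_ _ xyX).
  by rewrite in_graph.
rewrite negb_exists => /forallP nop; right.
have avoid p : {X | core X & p \notin X}.
  by apply/sig2W; have := nop p; rewrite negb_forall => /existsP[X]; rewrite negb_imply => /andP[]; exists X.
pose X p := s2val (avoid p).
have cX p : core (X p) by rewrite /X; case: (avoid p).
have nX p : p \notin X p by rewrite /X; case: (avoid p).
pose X1 := X (x0, x0).
have meet Y Z : core Y -> core Z -> ~~ [disjoint Y & Z].
  by move=> /andP[cY hY] /andP[cZ hZ]; exact: (core_meet Aint (ltnW n_gt1) t0_gt0 le_nR le_t0R le_qR).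
have sub : A \subset rest :|:
    \bigcup_(p in X1) \bigcup_(p' in X p) extending setT [set p; p'].
  apply/subsetP=> s As; rewrite in_setU; case: (boolP (s \in rest)) => //=.
  rewrite inE As /= negb_forall => /existsP[Y]; rewrite negb_imply negbK => /andP[cY sY].
  have := meet _ _ cY (cX (x0, x0)); rewrite -setI_eq0 => /set0Pn[p]; rewrite inE => /andP[pY pX1].
  have := meet _ _ cY (cX p); rewrite -setI_eq0 => /set0Pn[p']; rewrite inE => /andP[pY' pX'].
  apply/bigcupP; exists p => //; apply/bigcupP; exists p' => //.
  by rewrite inE in_setT subUset !sub1set !(subsetP sY).
apply: leq_trans (subset_leq_card sub) _.
set V := \bigcup_(p in X1) _.
have cV : #|V| <= q ^ 2 * (n - 2)`!.
  have -> : q ^ 2 * (n - 2)`! = q * (q * (n - 2)`!) by rewrite -mulnn mulnA.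
  apply: leq_trans (leq_card_bigcup (m := q * (n - 2)`!) _) _ => [p pX1|].
    apply: leq_trans (leq_card_bigcup (m := (n - 2)`!) _) _ => [p' pX'|].
      apply: leq_trans (card_extending _ _) _; rewrite cards2.
      by case: eqP => // e; case/negP: (nX p); rewrite {1}e.
    by rewrite leq_mul2r; have /andP[_ ->] := cX p; rewrite orbT.
  by rewrite leq_mul2r; have /andP[_ ->] := cX (x0, x0); rewrite orbT.
have [+ _] := leq_card_setU rest V.
have : #|rest| <= (n - 2)`!.
  by apply: leq_trans card_rest; rewrite leq_pmulr // muln_gt0 expn_gt0 (ltnW n_gt1).
move: cV; lia.
Qed.
End Stability.

(** * Permutations excluded by a second exceptional member *)

Section Loss.
Variables (T : finType) (i j : T) (s1 s2 : {perm T}).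
Let n := #|T|.
Hypothesis (n_gt3 : 3 < n) (neq12 : s1 != s2) (s1i : s1 i != j) (s2i : s2 i != j).

(** Otherwise [s1] and [s2] agree except perhaps at [i] and where [s1] takes the value [j]. As
    [s2 i != j], they take [j] at the same point, and bijectivity forces agreement at [i]. *)
Lemma disagreement_off : exists a, [/\ a != i, s1 a != j & s1 a != s2 a].
Proof.
case: (boolP [exists a, [&& a != i, s1 a != j & s1 a != s2 a]]).
  by case/existsP=> a /and3P[]; exists a.
rewrite negb_exists => /forallP H.
have eq12 a : a != i -> s1 a != j -> s1 a = s2 a.
  by move=> ai aj; have := H a; rewrite ai aj negbK => /eqP.
have eqi a : a != i -> s1 a = s2 a.
  move=> ai; have [aj|] := eqVneq (s1 a) j; last exact: eq12.
  pose y := (s2^-1)%g j; have yj : s2 y = j by rewrite /y permKV.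
  have yi : y != i by apply: contra s2i => /eqP <-; rewrite yj.
  have [ya|ya] := eqVneq y a; first by rewrite aj -ya yj.
  have sy : s1 y != j by rewrite -aj (inj_eq perm_inj).
  by have := eq12 _ yi sy; rewrite yj => e; rewrite e eqxx in sy.
case/eqP: neq12; apply/permP=> a; have [->|] := eqVneq a i; last exact: eqi.
pose z := (s1^-1)%g (s2 i); have zi : s1 z = s2 i by rewrite /z permKV.
have [zz|zni] := eqVneq z i; first by rewrite -zi zz.
have e : z = i by apply: (@perm_inj _ s2); rewrite -eqi.
by rewrite e eqxx in zni.
Qed.

Definition avoiding_hits : {set {perm T}} :=
  [set s : {perm T} | [&& s i == j, [exists x, s x == s1 x] & [forall x, s x != s2 x]]].

(* Among the permutations with two prescribed values the mean number of
   agreements with [s2] is at most 1, so at least half of them agree with [s2]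
   at most once; one transposition then removes the agreement. *)
Lemma card_avoiding_hits : (n - 2)`! <= #|avoiding_hits| * (2 * n ^ 2).
Proof.
have [a [ai s1a s12a]] := disagreement_off.
pose X : {set T * T} := [set (i, j); (a, s1 a)].
have cX : #|X| = 2 by rewrite cards2 xpair_eqE eq_sym (negPf ai).
pose L := extending setT X.
have inL s : (s \in L) = (s i == j) && (s a == s1 a).
  by rewrite inE in_setT subUset !sub1set !in_graph.
have cL : #|L| = (n - 2)`!.
  rewrite -cX; apply: (@card_extending_eq _ (s1 * tperm (s1 i) j)%g).
  rewrite subUset !sub1set !in_graph !permM tpermL eqxx /= tpermD //.
    by rewrite (inj_eq perm_inj) eq_sym.
  by rewrite eq_sym.
pose f (s : {perm T}) := #|[set x | s x == s2 x]|.
have fE s : f s = \sum_x (s x == s2 x) by rewrite /f -sum1dep_card big_mkcond.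
(* The points [i] and [a] contribute nothing, each of the n - 2 others at most (n - 3)!. *)
have sumf : \sum_(s in L) f s <= (n - 2)`!.
  under eq_bigr do rewrite fE.
  rewrite exchange_big /=.
  rewrite (bigD1 i) //= [X in X + _]big1 ?add0n; last first.
    by move=> s; rewrite inL => /andP[/eqP -> _]; rewrite eq_sym (negPf s2i).
  rewrite (bigD1 a) //= [X in X + _]big1 ?add0n; last first.
    by move=> s; rewrite inL => /andP[_ /eqP ->]; rewrite (negPf s12a).
  have card_rest : #|[pred x | (x != i) && (x != a)]| = n - 2.
    rewrite /n -(cardC (pred2 i a)) (_ : #|pred2 i a| = 2) ?addKn; last by rewrite card2 eq_sym ai.
    by apply: eq_card => x; rewrite !inE negb_or.
  have : (n - 2) * (n - 3)`! <= (n - 2)`!.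
    by have -> : n - 2 = (n - 3).+1 by lia.
  apply: leq_trans; rewrite -card_rest -sum_nat_const; apply: leq_sum => x /andP[xi xa].
  rewrite (_ : \sum_(s in L) _ = #|extending setT ((x, s2 x) |: X)|); last first.
    rewrite -sum1_card [LHS]big_mkcond [RHS]big_mkcond /=; apply: eq_bigr => s _.
    rewrite inL /extending !in_set /X !subUset !sub1set !in_graph /=.
    by case: (s x == _); case: (s i == _); case: (s a == _).
  apply: leq_trans (card_extending _ _) _; rewrite cardsU1 cX.
  by rewrite !inE !xpair_eqE (negPf xi) (negPf xa).
pose L1 := [set s in L | f s <= 1].
have cL1 : (n - 2)`! <= 2 * #|L1|.
  have e : #|L| = #|L1| + #|[set s in L | 1 < f s]|.
    rewrite -(cardsID [set s | f s <= 1] L); congr (_ + _); apply: eq_card => s.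
      by rewrite !inE.
    by rewrite !inE -ltnNge andbC.
  have : 2 * #|[set s in L | 1 < f s]| <= \sum_(s in L) f s.
    rewrite -sum1dep_card big_distrr /= big_mkcondr /=.
    by apply: leq_sum => s _; case: ifP.
  move: e sumf; rewrite cL; lia.
(* Each of the n^2 pairs covers at most |avoiding_hits| permutations; the pair (i, i) gives the
   identity, for those already avoiding [s2]. *)
have sub : L1 \subset \bigcup_(p in [set: T * T]) [set s | (tperm p.1 p.2 * s)%g \in avoiding_hits].
  apply/subsetP=> s; rewrite inE inL => /andP[/andP[/eqP si /eqP sa]].
  rewrite leq_eqVlt ltnS leqn0 => /orP[/cards1P[x Hx]|f0]; last first.
    apply/bigcupP; exists (i, i); rewrite ?in_setT // inE tperm1 mul1g inE si eqxx /=.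
    apply/andP; split; first by apply/existsP; exists a; rewrite sa.
    apply/forallP=> x; move: f0; rewrite cards_eq0 => /eqP/setP/(_ x); rewrite !inE.
    by move=> ->.
  have agree y : (s y == s2 y) = (y == x) by have /setP/(_ y) := Hx; rewrite !inE.
  have ix : i != x by rewrite -agree si eq_sym.
  have ax : a != x by rewrite -agree sa.
  have xi : x != i by rewrite eq_sym.
  have xa : x != a by rewrite eq_sym.
  (* Since n > 3 there is a point [z] whose swap with [x] disturbs neither prescribed value. *)
  have [z] : exists z, z \notin [set i; a; x].
    apply/existsP; rewrite -negb_forall; apply/negP=> /forallP all.
    have : n <= #|[set i; a; x]|.
      by rewrite /n -cardsT; apply/subset_leq_card/subsetP=> y _; apply: all.
    by have := cardsU1 x [set i; a]; rewrite setUC cards2; case: (_ \notin _); case: (_ == _); lia.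
  rewrite !inE !negb_or => /andP[/andP[zi za] zx].
  apply/bigcupP; exists (x, z); rewrite ?in_setT // !inE /=.
  rewrite permM (tpermD xi zi) si eqxx /=; apply/andP; split.
    by apply/existsP; exists a; rewrite permM (tpermD xa za) sa.
  apply/forallP=> y; rewrite permM; case: tpermP => [->|->|/eqP yx /eqP yz].
  - have /eqP <- : s x == s2 x by rewrite agree.
    by rewrite (inj_eq perm_inj).
  - have /eqP -> : s x == s2 x by rewrite agree.
    by rewrite (inj_eq perm_inj) eq_sym.
  - by rewrite agree.
have := subset_leq_card sub.
move/leq_trans/(_ (leq_card_bigcup (m := #|avoiding_hits|) _)) => H.
have H1 : #|L1| <= n ^ 2 * #|avoiding_hits|.
  apply: leq_trans (H _) _ => [p _|]; last by rewrite cardsT card_prod mulnn.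
  rewrite -(card_imset _ (mulgI (tperm p.1 p.2))); apply/subset_leq_card/subsetP=> s.
  by case/imsetP=> t; rewrite inE => + ->.
lia.
Qed.
End Loss.

(** * Size and translates of the extremal family *)

Lemma bonferroni_bigcup (I X : finType) (D : {set I}) (F : I -> {set X}) (a b : nat) :
    (forall i, i \in D -> a <= #|F i|) ->
    (forall i j, i \in D -> j \in D -> i != j -> #|F i :&: F j| <= b) ->
  #|D| * a <= #|\bigcup_(i in D) F i| + #|D| ^ 2 * b.
Proof.
move: {2}#|D| (erefl #|D|) => k; elim: k D => [|k IH] D cD Fa Fb.
  by rewrite cD mul0n.
have /card_gt0P[x xD] : 0 < #|D| by rewrite cD.
have cD' : #|D :\ x| = k by move: (cardsD1 x D); rewrite xD cD => -[].
have sD i : i \in D :\ x -> i \in D by rewrite inE => /andP[].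
have := IH (D :\ x) cD' (fun i h => Fa i (sD i h)) (fun i j hi hj => Fb i j (sD i hi) (sD j hj)).
rewrite (big_setD1 x xD) /= cD' cD.
set V := \bigcup_(i in _) _ => H.
have cI : #|F x :&: V| <= k * b.
  rewrite /V big_distrr /= -cD'; apply: leq_card_bigcup => i.
  by rewrite !inE => /andP[ix iD]; apply: Fb; rewrite // eq_sym.
have := cardsUI (F x) V; have := Fa x xD; nia.
Qed.

Section FamilyC.
Variable m : nat.
Local Notation T := 'I_m.+2.
Local Notation one := (pt1 m).
Local Notation two := (pt2 m).

Lemma ge2_ord (i : T) : (2 <= val i) = (i != one) && (i != two).
Proof. by rewrite -!val_eqE /=; case: i => -[|[|i]]. Qed.

Lemma lift_perm_ord0_inj k : injective (@lift_perm k ord0 ord0).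
Proof.
move=> t u e; apply/permP=> i; apply: (@lift_inj k.+1 ord0).
by rewrite -!(lift_perm_lift ord0 ord0) e.
Qed.

(** By counting: the k! lifts lie among the k! permutations fixing [ord0]. *)
Lemma lift_perm_ord0_onto k (s : {perm 'I_k.+1}) : s ord0 = ord0 ->
  exists t : {perm 'I_k}, s = lift_perm ord0 ord0 t.
Proof.
move=> s0.
pose phi := @lift_perm k ord0 ord0.
have phi_inj : injective phi := @lift_perm_ord0_inj k.
have : phi @: setT \subset extending setT [set (ord0, ord0)].
  apply/subsetP=> _ /imsetP[t _ ->]; rewrite inE in_setT sub1set in_graph.
  by rewrite lift_perm_id.
move/subset_cardP.
rewrite card_imset // (@card_extending_eq _ 1%g); last by rewrite sub1set in_graph perm1.
rewrite cards1 cardsT card_Sn card_ord subSS subn0 => /(_ erefl) e.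
have : s \in phi @: setT by rewrite e inE in_setT sub1set in_graph s0.
by case/imsetP=> t _ ->; exists t.
Qed.

(** [P] tells which points move, to cover both no further fixed point and exactly one prescribed
    further fixed point. *)
Lemma card_fixing_derangements k (P : pred 'I_k) :
  #|[set s : {perm 'I_k.+1} | (s ord0 == ord0) && [forall i, (s (lift ord0 i) != lift ord0 i) == P i]]|
   = #|[set t : {perm 'I_k} | [forall i, (t i != i) == P i]]|.
Proof.
rewrite -(card_imset _ (@lift_perm_ord0_inj k)).
apply: eq_card => s; rewrite inE; apply/andP/imsetP => [[/eqP s0 /forallP sP]|[t]].
  have [t et] := lift_perm_ord0_onto s0; exists t => //; rewrite inE; apply/forallP=> i.
  by have := sP i; rewrite et lift_perm_lift (inj_eq lift_inj).
rewrite inE => /forallP tP ->; rewrite lift_perm_id; split=> //; apply/forallP=> i.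
by rewrite lift_perm_lift (inj_eq lift_inj).
Qed.

(** A permutation fixing 1 cannot agree with the transposition at 1 or 2, so agreement with it means
    a fixed point beyond 2. This exhibits [familyC] as a [star_with]. *)
Lemma mem_familyC s : (s \in familyC m) =
  ((s one == one) && [exists x, s x == tperm one two x]) || (s == tperm one two).
Proof.
rewrite !inE; congr (_ || _); apply: andb_id2l => /eqP s1.
apply/existsP/existsP=> -[x]; first by rewrite ge2_ord => /andP[/andP[x1 x2] sx]; exists x; rewrite tpermD // eq_sym.
move=> sx; exists x; move: sx; rewrite ge2_ord.
have [->|x1] := eqVneq x one; first by rewrite tpermL s1.
have [->|x2] := eqVneq x two; last by rewrite tpermD // eq_sym.
by rewrite tpermR -{1}s1 (inj_eq perm_inj).
Qed.

Lemma card_familyC : #|familyC m| = (m.+1)`! - derangements m.+1 - derangements m + 1.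
Proof.
(* Permutations fixing 1 are split by their other fixed points: some beyond 2 ([C0]), none ([N0]),
   only 2 ([N1]). *)
pose L := [set s : {perm T} | s one == one].
pose C0 := [set s : {perm T} | (s one == one) && [exists i : T, (2 <= val i) && (s i == i)]].
pose N0 := [set s : {perm T} | (s one == one) && [forall i, (s (lift ord0 i) != lift ord0 i) == true]].
pose N1 := [set s : {perm T} | (s one == one) && [forall i, (s (lift ord0 i) != lift ord0 i) == (i != ord0)]].
have cL : #|L| = (m.+1)`!.
  transitivity #|extending setT [set (one, one)]|.
    by apply: eq_card => s; rewrite !inE sub1set in_graph.
  rewrite (@card_extending_eq _ 1%g); last by rewrite sub1set in_graph perm1.
  by rewrite cards1 card_ord subSS subn0.
have cN0 : #|N0| = derangements m.+1.
  rewrite card_fixing_derangements /derangements; apply: eq_card => s; rewrite !inE.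
  by apply: eq_forallb => i; rewrite eqb_id.
have cN1 : #|N1| = derangements m.
  rewrite card_fixing_derangements.
  transitivity #|[set t : {perm 'I_m.+1} | (t ord0 == ord0) && [forall i, (t (lift ord0 i) != lift ord0 i) == true]]|.
    apply: eq_card => t; rewrite !inE; apply/forallP/andP=> [H|[t0 /forallP H] i].
      split; first by have := H ord0; rewrite eqxx; case: (t ord0 == ord0).
      by apply/forallP=> i; have := H (lift ord0 i).
    by case: (unliftP ord0 i) => [j ->|->]; [rewrite (eqP (H j)) | rewrite t0].
  rewrite card_fixing_derangements /derangements; apply: eq_card => s; rewrite !inE.
  by apply: eq_forallb => i; rewrite eqb_id.
have LE : L = C0 :|: (N0 :|: N1).
  apply/setP=> s; rewrite !inE; case: (s one == one) => //=; symmetry.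
  case: (boolP [exists i : T, _]) => //=; rewrite negb_exists => /forallP H.
  have H' i : s (lift ord0 (lift ord0 i)) != lift ord0 (lift ord0 i).
    by have := H (lift ord0 (lift ord0 i)).
  apply/orP; case: (boolP (s two == two)) => s2; [right|left]; apply/forallP=> i;
  case: (unliftP ord0 i) => [j ->|->]; rewrite ?H' //;
  by rewrite -/two s2.
have d1 : [disjoint C0 & N0 :|: N1].
  rewrite -setI_eq0; apply/eqP/setP=> s; rewrite !inE; apply/negP.
  case/andP=> /andP[_ /existsP[i /andP[i2 si]]].
  have [k ek] : exists k, i = lift ord0 (lift ord0 k).
    move: i2; rewrite ge2_ord; case: (unliftP ord0 i) => [j ->|->] //.
    by case: (unliftP ord0 j) => [k ->|->]; [exists k | rewrite andbF].
  by case/orP=> /andP[_ /forallP/(_ (lift ord0 k))]; rewrite -ek si.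
have d2 : [disjoint N0 & N1].
  rewrite -setI_eq0; apply/eqP/setP=> s; rewrite !inE; apply/negP.
  by case/andP=> /andP[_ /forallP/(_ ord0) /eqP +] /andP[_ /forallP/(_ ord0) /eqP] => ->.
have := cL; rewrite LE cardsU disjoint_setI0 // cards0 subn0 cardsU disjoint_setI0 // cards0 subn0.
rewrite cN0 cN1 => <-.
have -> : familyC m = C0 :|: [set tperm one two] by [].
have dC : [disjoint C0 & [set tperm one two]].
  by rewrite disjoint_sym disjoints1 !inE tpermL.
by rewrite cardsU disjoint_setI0 // cards0 cards1 subn0 [derangements _ + _]addnC addnA !addnK.
Qed.

(** Bonferroni over [K] possible fixed points beyond 2; K^2 <= m keeps the correction K^2 (m - 1)!
    below m!. *)
Lemma card_familyC_geq K : 0 < m -> K ^ 2 <= m -> (K - 1) * m`! <= #|familyC m|.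
Proof.
move=> m_gt0 leK.
pose D := [set i : T | 2 <= val i < K.+2].
pose F (i : T) := extending setT [set (one, one); (i, i)].
have id_ext (X : {set T * T}) : (forall p, p \in X -> p.1 = p.2 :> T) -> #|extending setT X| = (m.+2 - #|X|)`!.
  move=> H; rewrite (@card_extending_eq _ 1%g) ?card_ord //.
  by apply/subsetP=> -[x y] /H /= ->; rewrite in_graph perm1.
have leKm : K <= m by nia.
have cD : #|D| = K.
  pose g (k : 'I_K) : T := inord (k.+2).
  have gE k : val (g k) = k.+2 by rewrite /= inordK //; have := ltn_ord k; lia.
  rewrite -[RHS]card_ord -(card_imset predT (_ : injective g)); last first.
    by move=> k l /(congr1 val); rewrite !gE => -[] /val_inj.
  apply: eq_card => i; rewrite inE; apply/idP/imsetP => [|[k _ ->]].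
    case/andP=> /= i2 iK; have hk : i - 2 < K by lia.
    by exists (Ordinal hk) => //; apply: val_inj; rewrite gE /=; lia.
  by rewrite gE; have := ltn_ord k; lia.
have D1 i : i \in D -> i != one by rewrite inE ge2_ord => /andP[/andP[]].
have H := @bonferroni_bigcup _ _ D F m`! (m - 1)`! _ _.
have : #|D| * m`! <= #|\bigcup_(i in D) F i| + #|D| ^ 2 * (m - 1)`!.
  apply: H => [i /D1 i1|i j /D1 i1 /D1 j1 ij].
    rewrite id_ext => [|p]; last by rewrite !inE => /orP[] /eqP ->.
    by rewrite cards2 xpair_eqE eq_sym (negPf i1) subSS subSS subn0.
  have -> : F i :&: F j = extending setT ((j, j) |: [set (one, one); (i, i)]).
    apply/setP=> s; rewrite in_setI !in_set !subUset !sub1set /=.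
    by do 3!case: (_ \in graph s).
  rewrite id_ext => [|p]; last by rewrite !inE => /or3P[] /eqP ->.
  rewrite cardsU1 cards2 !inE !xpair_eqE [one == i]eq_sym (negPf i1) (negPf j1) [j == i]eq_sym (negPf ij) /=.
  by rewrite !subSS.
have sub : \bigcup_(i in D) F i \subset familyC m.
  apply/bigcupsP=> i; rewrite inE => /andP[i2 _]; apply/subsetP=> s.
  rewrite !in_set subUset !sub1set !in_graph => /andP[_ /andP[-> si]] /=.
  by apply/orP; left; apply/existsP; exists i; rewrite i2.
have := subset_leq_card sub; rewrite cD.
have : K ^ 2 * (m - 1)`! <= m`!.
  case: m m_gt0 leK => // m' _ h; rewrite factS subSS subn0 leq_mul2r h orbT //.
move=> h1 h2 h3; rewrite mulnBl mul1n leq_subLR addnC.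
exact: leq_trans h3 (leq_add h2 h1).
Qed.

(** The Hilton-Milner shape of [familyC], for any cell and any exceptional member. *)
Definition star_with (i j : T) (u : {perm T}) : {set {perm T}} :=
  [set s : {perm T} | (s i == j) && [exists x, s x == u x]] :|: [set u].

Lemma star_with_translate (i j : T) (u : {perm T}) : u i != j ->
  exists p t, star_with i j u = double_translate (familyC m) p t.
Proof.
move=> uij.
(* [p] must send [one] to [j] and [two] to [u i]; [v] is where the first transposition leaves [two].
   Then [t] is forced by [tE]. *)
pose v := tperm one j two.
have vj : v != j by rewrite /v -{2}(tpermL one j) (inj_eq perm_inj).
pose p : {perm T} := (tperm one j * tperm v (u i))%g.
have p1 : p one = j by rewrite permM tpermL tpermD.
have p2 : p two = u i by rewrite permM -/v tpermL.
pose t : {perm T} := (u * p^-1 * (tperm one two)^-1)%g.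
have ti : t i = one by rewrite !permM tpermV -p2 permK tpermR.
have tE : (t * tperm one two * p)%g = u.
  by rewrite /t mulgKV mulgKV.
clearbody t p.
exists p, t.
have memDT s : (s \in double_translate (familyC m) p t) = ((t^-1 * s * p^-1)%g \in familyC m).
  apply/imsetP/idP=> [[c cC ->]|h]; first by rewrite -!mulgA mulgV mulg1 mulKg.
  by exists (t^-1 * s * p^-1)%g => //; rewrite -!mulgA mulVg mulg1 mulKVg.
apply/setP=> s; rewrite memDT mem_familyC !inE; congr (_ || _).
  have tV1 : t^-1%g one = i by rewrite -ti permK.
  have pV x y : (p^-1%g x == y) = (x == p y) by rewrite -(inj_eq (@perm_inj _ p)) permKV.
  rewrite !permM tV1 pV p1; congr (_ && _).
  apply/existsP/existsP=> -[x].
    move=> /eqP sx; exists (t x); rewrite 2!permM permK pV sx -tE 2!permM.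
    by [].
  rewrite 2!permM pV => /eqP sx; exists (t^-1%g x); rewrite sx -tE 2!permM permKV.
  by [].
apply/eqP/eqP=> [->|e]; first by rewrite -tE -!mulgA mulgV mulg1 mulKg.
by rewrite -tE -e -!mulgA mulVg mulg1 mulKVg.
Qed.

Lemma card_double_translate (C : {set {perm T}}) p t : #|double_translate C p t| = #|C|.
Proof. by apply: card_imset => s s' /mulIg /mulgI. Qed.

End FamilyC.

(** * Choice of parameters and conclusion *)

Lemma cube_root_exists n : exists k, k ^ 3 <= n < k.+1 ^ 3.
Proof.
elim: n => [|n [k /andP[le lt]]]; first by exists 0.
case: (leqP (k.+1 ^ 3) n.+1) => [le'|lt']; last by exists k; rewrite lt' (leq_trans le).
exists k.+1; rewrite le' /=; apply: (leq_ltn_trans lt).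
by rewrite ltn_exp2r.
Qed.

(* [R] is about [n ^ (2/3)] and [t0] about [n ^ (1/3)]. *)
Lemma parameters_exist n : 2 ^ 90 <= n -> exists R t0,
  [/\ 0 < t0, 512 * n <= t0 * R, 128 * t0 <= R, 2 * 13 <= R &
      forall x, 13 < x -> 2 * n ^ 4 * (4 * R) ^ x <= n ^ x].
Proof.
move=> n_big; have [k /andP[le_kn lt_nk]] := cube_root_exists n.
have k_big : 2 ^ 30 <= k.
  by rewrite -ltnS -(@ltn_exp2r _ _ 3) // -expnM; apply: leq_ltn_trans n_big lt_nk.
have k_gt0 : 0 < k by apply: leq_trans k_big; rewrite expn_gt0.
have le_nk : n <= 2 ^ 3 * k ^ 3.
  by apply: leq_trans (ltnW lt_nk) _; rewrite -expnMn leq_exp2r //; lia.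
exists (k ^ 2), (2 ^ 12 * k); split.
- by rewrite muln_gt0 expn_gt0.
- have -> : 2 ^ 12 * k * k ^ 2 = 512 * (2 ^ 3 * k ^ 3).
    by rewrite -[512]/(2 ^ 9) mulnA -expnD -mulnA -expnS.
  by rewrite leq_mul2l le_nk orbT.
- rewrite -[128]/(2 ^ 7) mulnA -expnD -mulnn leq_mul2r; apply/orP; right.
  by apply: leq_trans k_big; rewrite leq_exp2l.
- apply: (@leq_trans k); last by rewrite -mulnn leq_pmulr.
  by apply: leq_trans k_big; apply: (@leq_trans (2 ^ 5)) => //; rewrite leq_exp2l.
move=> x x_gt.
apply: (@leq_trans ((k ^ 3) ^ x)); last by rewrite leq_exp2r // (leq_trans _ x_gt).
have -> : (k ^ 3) ^ x = k ^ x * (k ^ 2) ^ x by rewrite -expnMn -expnS.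
rewrite expnMn mulnA leq_mul2r; apply/orP; right.
apply: (@leq_trans (2 * (2 ^ 3 * k ^ 3) ^ 4 * 4 ^ x)).
  by rewrite leq_mul2r leq_mul2l leq_exp2r // le_nk !orbT.
have -> : k ^ x = k ^ 12 * k ^ (x - 12) by rewrite -expnD subnKC // (leq_trans _ x_gt).
have -> : 2 * (2 ^ 3 * k ^ 3) ^ 4 * 4 ^ x = k ^ 12 * 2 ^ (1 + 12 + 2 * x).
  have e4 : 4 ^ x = 2 ^ (2 * x) by rewrite expnM.
  by rewrite expnMn -(expnM 2) -(expnM k) e4 mulnA -expnS mulnAC -expnD mulnC.
rewrite leq_mul2l; apply/orP; right.
(* The exponents must satisfy 13 + 2 x <= 30 (x - 12), which at x = 14 reads 41 <= 60. *)
apply: (@leq_trans ((2 ^ 30) ^ (x - 12))); last by rewrite leq_exp2r //; lia.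
by rewrite -expnM leq_exp2l //; lia.
Qed.

Lemma card_star_with m (i j : 'I_m.+2) (u : {perm 'I_m.+2}) :
  u i != j -> #|star_with i j u| = #|familyC m|.
Proof. by move=> /star_with_translate[p [t ->]]; rewrite card_double_translate. Qed.

(** With a second exceptional member, the trimmed star of [u] contains [A :\: F], the excluded set
    [H] with |H| >= |F|, and [u], all disjoint; so |A| < |C|, a contradiction. *)
Lemma near_star m (A : {set {perm 'I_m.+2}}) (i j : 'I_m.+2) :
    2 <= m -> intersecting A -> ~ centred A ->
    #|[set s in A | s i != j]| * (2 * m.+2 ^ 2) <= m`! ->
    #|familyC m| <= #|A| ->
  exists2 u : {perm 'I_m.+2}, u i != j & A = star_with i j u.
Proof.
move=> m2 Aint Anc; set F := [set s in A | s i != j] => cF leCA.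
have [F0|[u uF]] := set_0Vmem F.
  case: Anc; exists i, j => s As; apply/eqP/negPn/negP => sij.
  by have : s \in F; [rewrite inE As | rewrite F0 inE].
have [Au uij] : u \in A /\ u i != j by move: uF; rewrite inE => /andP.
have card_u := card_star_with uij.
have AF_sub : A :\: F \subset star_with i j u.
  apply/subsetP=> s; rewrite !inE => /andP[+ As]; rewrite As /= negbK => ->.
  by have [x e] := Aint _ _ As Au; apply/orP; left; apply/existsP; exists x; rewrite e.
case: (boolP [exists s2 in F, s2 != u]) => [/exists_inP[s2 s2F s2u]|].
  have [As2 s2ij] : s2 \in A /\ s2 i != j by move: s2F; rewrite inE => /andP.
  have n_gt3 : 3 < #|'I_m.+2| by rewrite card_ord.
  have us2 : u != s2 by rewrite eq_sym.
  have := card_avoiding_hits n_gt3 us2 uij s2ij.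
  rewrite card_ord !subSS subn0; set H := avoiding_hits _ _ _ _ => leH.
  have leFH : #|F| <= #|H|.
    by rewrite -(@leq_pmul2r (2 * m.+2 ^ 2)) ?muln_gt0 ?expn_gt0 //; apply: leq_trans cF leH.
  have dis : [disjoint A :\: F & H].
    rewrite -setI_eq0; apply/eqP/setP=> s; rewrite in_setI in_setD [s \in H]inE [s \in set0]inE.
    apply/negP=> /andP[/andP[_ As] /and3P[_ _ /forallP sx]].
    by have [x e] := Aint _ _ As As2; have := sx x; rewrite e eqxx.
  have unot : u \notin (A :\: F) :|: H.
    by rewrite !in_setU in_setD uF [u \in H]inE (negPf uij).
  have sub : u |: ((A :\: F) :|: H) \subset star_with i j u.
    rewrite !subUset sub1set AF_sub /star_with !inE eqxx orbT /=.
    by apply/subsetP=> s; rewrite !inE => /and3P[-> -> _].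
  have := subset_leq_card sub; rewrite cardsU1 unot cardsU disjoint_setI0 // cards0 subn0 card_u.
  have cA : #|A| = #|F| + #|A :\: F|.
    by rewrite -(cardsID F A) (setIidPr _) //; apply/subsetP=> s; rewrite inE => /andP[].
  move: leCA; rewrite cA => h1 /(leq_trans)/(_ h1); rewrite add1n ltnNge [#|F| + _]addnC leq_add2l leFH.
  by [].
rewrite negb_exists_in => /forall_inP Fu; exists u => //.
apply/eqP; rewrite eqEcard card_u leCA andbT; apply/subsetP=> s As.
case: (boolP (s \in F)) => [/Fu|sF].
  by rewrite negbK => /eqP ->; rewrite !inE eqxx orbT.
by apply: (subsetP AF_sub); rewrite in_setD sF.
Qed.

Theorem theorem7 :
  exists n0 : nat, forall m : nat, n0 <= m.+2 ->
    #|familyC m| = (m.+1)`! - derangements m.+1 - derangements m + 1 /\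
    forall A : {set {perm 'I_m.+2}},
      intersecting A -> ~ centred A ->
      #|A| <= #|familyC m| /\
      (#|A| = #|familyC m| <->
         exists p t : {perm 'I_m.+2}, A = double_translate (familyC m) p t).
Proof.
exists (2 ^ 90) => m m_big; split=> [|A Aint Anc]; first exact: card_familyC.
(* This case suffices: a family larger than C would be a translate, hence of equal size. *)
have key : #|familyC m| <= #|A| ->
    exists p t : {perm 'I_m.+2}, A = double_translate (familyC m) p t.
  move=> leCA.
  have [R [t0 [t0_gt0 le_nR le_t0R le_qR large]]] := parameters_exist m_big.
  have m_big2 : 256 ^ 2 <= m.
    rewrite -2!ltnS; apply: leq_trans m_big; rewrite -[256]/(2 ^ 8) -expnM.
    by apply: (@leq_trans (2 ^ 17)); rewrite ?leq_exp2l // [2 ^ 17]expnS; lia.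
  have m_gt1 : 1 < m by apply: leq_trans m_big2; rewrite -[1]/(1 ^ 2) ltn_exp2r.
  have := @stability _ A R t0 13 Aint; rewrite card_ord !subSS subn0.
  move=> /(_ isT t0_gt0 le_nR le_t0R le_qR large)[[x [y cF]]|cA].
    have [u uxy ->] := near_star m_gt1 Aint Anc cF leCA.
    exact: star_with_translate.
  (* Here 255 m! <= |C| <= |A| <= (13^2 + 1) m! is absurd. *)
  have := leq_trans (card_familyC_geq (ltnW m_gt1) m_big2) (leq_trans leCA cA).
  by rewrite leq_pmul2r ?fact_gt0.
have eqC : (exists p t : {perm 'I_m.+2}, A = double_translate (familyC m) p t) ->
    #|A| = #|familyC m|.
  by move=> [p [t ->]]; apply: card_double_translate.
split; last by split=> // e; apply: key; rewrite e.
by rewrite leqNgt; apply/negP=> h; move: (h); rewrite (eqC (key (ltnW h))) ltnn.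
Qed.
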